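(* For any graph $G$ we have $$\iota(G)\geq \left\lceil\frac{n(G)-\alpha_{\rm es}(G)}{\Delta(G)+1}\right\rceil.$$
   Context: All graphs are finite and simple; $n(G)$ is the number of vertices and $\Delta(G)$ the maximum degree of $G$. For $A\subseteq V(G)$, $N[A]=\bigcup_{a\in A}N[a]$ is the union of closed neighborhoods and $N(A)=N[A]- A$. A set $A\subseteq V(G)$ is an isolating set if $V(G)- N[A]$ is an independent set of $G$; the isolation number $\iota(G)$ is the minimum cardinality of an isolating set. A set $B\subseteq V(G)$ is an externally supported independence set (ESI-set) if $B$ is independent and every $v\in N(B)$ has a neighbor in $V(G)- N[B]$ (the empty set is an ESI-set). The externally supported independence number $\alpha_{\rm es}(G)$ is the maximum cardinality of an ESI-set of $G$. *)

(* Defs.v *)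
From mathcomp Require Import all_boot all_order all_algebra.

Set Implicit Arguments.
Unset Strict Implicit.
Unset Printing Implicit Defensive.

(* A finite simple graph is a finite vertex type T with an adjacency relation
   e : rel T that is symmetric and irreflexive; these two properties are not
   bundled here and have to be assumed where needed. *)
Section Graph.
Variables (T : finType) (e : rel T).
Implicit Types (A B : {set T}) (v : T).

Definition nbhd v : {set T} := [set w | e v w].

Definition closed_nbhd v : {set T} := v |: nbhd v.

Definition closed_nbhds A : {set T} := \bigcup_(a in A) closed_nbhd a.

Definition open_nbhds A : {set T} := closed_nbhds A :\: A.

Definition max_degree : nat := \max_(v : T) #|nbhd v|.

Definition independent A : bool :=
  [forall x in A, forall y in A, ~~ e x y].

Definition isolating A : bool := independent (~: closed_nbhds A).

Lemma isolating_setT : isolating [set: T].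
Proof.
apply/forall_inP => x; rewrite inE => /negP[].
by apply/bigcupP; exists x; rewrite !inE ?eqxx.
Qed.

(* [isolating_setT] makes this [arg min] a genuine minimum. *)
Definition isolation_number : nat :=
  #|[arg min_(A < [set: T] | isolating A) #|A|]|.

Definition esi_set B : bool :=
  independent B &&
  [forall v in open_nbhds B, [exists w in ~: closed_nbhds B, e v w]].

Definition esi_number : nat := \max_(B : {set T} | esi_set B) #|B|.

End Graph.

(* Main.v *)
(* If A is isolating then V - N[A] is an ESI-set: it is independent, and each of
   its outer neighbours v lies in N(a) for some a in A, where a is not in
   N[V - N[A]].  Hence alpha_es >= n - |N[A]| >= n - |A| (Delta + 1). *)
Require Import Defs.
From mathcomp Require Import all_boot all_order all_algebra.
Import Order.TTheory GRing.Theory Num.Theory.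
Local Open Scope ring_scope.

Lemma mem_closed_nbhds (T : finType) (e : rel T) (A : {set T}) (v : T) :
  reflect (exists2 a, a \in A & (v == a) || e a v) (v \in closed_nbhds e A).
Proof.
by apply: (iffP bigcupP) => -[a Aa av]; exists a => //; move: av; rewrite !inE.
Qed.

Lemma card_closed_nbhds (T : finType) (e : rel T) (A : {set T}) :
  (#|closed_nbhds e A| <= #|A| * (max_degree e).+1)%N.
Proof.
rewrite /closed_nbhds -sum_nat_const.
apply: (@leq_trans (\sum_(a in A) #|closed_nbhd e a|)%N).
  elim/big_rec2: _ => [|a m B _ le_Bm]; first by rewrite cards0.
  by apply: leq_trans (leq_card_setU _ _) _; rewrite leq_add2l.
(* [cardsU1] counts the centre [a] by a boolean, hence at most 1 on top of its degree. *)
apply: leq_sum => a _; rewrite cardsU1 -add1n leq_add ?leq_b1 //.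
exact: (leq_bigmax (F := fun v => #|nbhd e v|)).
Qed.

Lemma isolating_esi_setC (T : finType) (e : rel T) (A : {set T}) :
  symmetric e -> isolating e A -> esi_set e (~: closed_nbhds e A).
Proof.
move=> e_sym isoA; apply/andP; split=> //; apply/forall_inP => v.
rewrite inE => /andP[vNU /mem_closed_nbhds[b bU vb]].
have {vb} ebv : e b v by case/predU1P: vb vNU => [->|//]; rewrite bU.
have far a c : a \in A -> c \in ~: closed_nbhds e A -> ~~ ((c == a) || e a c).
  rewrite inE => Aa; apply: contra => ac.
  by apply/mem_closed_nbhds; exists a.
(* If [v] itself were in [A], its neighbour [b] would be dominated by [A], against [far]. *)
move: vNU; rewrite inE negbK => /mem_closed_nbhds[a Aa /predU1P[va|eav]].
  by have := far a b Aa bU; rewrite -va e_sym ebv orbT.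
(* The dominator [a] of [v] supports it externally: by [far], it neither equals nor is adjacent to
   any undominated vertex. *)
apply/exists_inP; exists a; last by rewrite e_sym.
rewrite inE; apply/mem_closed_nbhds => -[c cU ac].
by have := far a c Aa cU; rewrite eq_sym e_sym ac.
Qed.

(** Division-free form of the bound: the two summands account for the vertices outside and inside
    [closed_nbhds e A]. *)
Lemma card_le_esi_isolating (T : finType) (e : rel T) (A : {set T}) :
  symmetric e -> isolating e A ->
  (#|T| <= esi_number e + #|A| * (max_degree e).+1)%N.
Proof.
move=> e_sym isoA; rewrite -(cardsC (closed_nbhds e A)) addnC.
apply: leq_add; last exact: card_closed_nbhds.
apply: (leq_bigmax_cond (F := fun B : {set T} => #|B|)).
exact: isolating_esi_setC.
Qed.

Theorem theorem1 (T : finType) (e : rel T)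
    (e_sym : symmetric e) (e_irr : irreflexive e) :
  Num.ceil ((#|T|%:R - (esi_number e)%:R) / ((max_degree e)%:R + 1) : rat)
    <= (isolation_number e)%:Z.
Proof.
rewrite ceil_le_int natr1 ler_pdivrMr ?ltr0Sn // lerBlDl.
rewrite -[_%:~R]/(_%:R) -natrM -natrD ler_nat /isolation_number.
case: arg_minnP => [|A isoA _]; first exact: isolating_setT.
exact: card_le_esi_isolating.
Qed.
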